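(* Let $n\ge1$ and $\mathscr{N}_n=\{(A,B)\in M_n(\mathbb{C})\times M_n(\mathbb{C}) : AB+BA=0,\ A\text{ nilpotent}\}$. Then the irreducible components of $\mathscr{N}_n$ are exactly the varieties $\mathscr{N}_\lambda$, one for each partition $\lambda$ of $n$, and $\dim\mathscr{N}_\lambda=n^2$ for every partition $\lambda$ of $n$.
   Context: $G=GL_n(\mathbb{C})$ acts on $\mathscr{N}_n$ by simultaneous conjugation. For a partition $\lambda$ of $n$, $J_\lambda(0)$ denotes the nilpotent Jordan normal form with Jordan blocks of sizes $\lambda_1,\lambda_2,\dots$, and $\mathscr{N}_\lambda$ is the Zariski closure in $\mathscr{N}_n$ of the union of the $G$-orbits of all pairs $(J_\lambda(0),B)\in\mathscr{N}_n$. *)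

(* Defs.v *)
From HB Require Import structures.
From mathcomp Require Import all_boot all_order all_algebra.
From mathcomp Require Import reals complex.
Set Implicit Arguments. Unset Strict Implicit. Unset Printing Implicit Defensive.
Import Order.TTheory GRing.Theory Num.Theory.
Local Open Scope ring_scope.

(* The field of complex numbers is modelled as R[i] = complex R for an
   arbitrary R : realType (any realType is isomorphic to the reals). *)

Section Defs.
Variables (R : realType) (n : nat).
Local Notation C := (complex R).
Local Notation X := ('M[C]_n * 'M[C]_n)%type.

Definition subset (A B : X -> Prop) := forall x, A x -> B x.
Definition seteq (A B : X -> Prop) := forall x, A x <-> B x.
Definition psubset (A B : X -> Prop) := subset A B /\ ~ subset B A.

Inductive polyfun : (X -> C) -> Prop :=
| pf_const (c : C) : polyfun (fun _ => c)
| pf_coordA (i j : 'I_n) : polyfun (fun p => p.1 i j)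
| pf_coordB (i j : 'I_n) : polyfun (fun p => p.2 i j)
| pf_add f g : polyfun f -> polyfun g -> polyfun (fun p => f p + g p)
| pf_mul f g : polyfun f -> polyfun g -> polyfun (fun p => f p * g p).

Definition zclosed (Z : X -> Prop) :=
  exists S : (X -> C) -> Prop, (forall f, S f -> polyfun f) /\
    forall x, Z x <-> (forall f, S f -> f x = 0).

Definition zclosure (A : X -> Prop) : X -> Prop :=
  fun x => forall Z, zclosed Z -> subset A Z -> Z x.

Definition irreducible (Z : X -> Prop) :=
  (exists x, Z x) /\
  forall Z1 Z2, zclosed Z1 -> zclosed Z2 ->
    subset Z (fun x => Z1 x \/ Z2 x) -> subset Z Z1 \/ subset Z Z2.

Definition irreducible_component (Y Z : X -> Prop) :=
  subset Z Y /\ irreducible Z /\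
  forall W, irreducible W -> subset Z W -> subset W Y -> seteq W Z.

Definition has_chain (Z : X -> Prop) (d : nat) :=
  exists F : nat -> (X -> Prop),
    (forall i, (i <= d)%N -> [/\ zclosed (F i), irreducible (F i) & subset (F i) Z])
    /\ forall i, (i < d)%N -> psubset (F i) (F i.+1).
Definition dim_eq (Z : X -> Prop) (d : nat) := has_chain Z d /\ ~ has_chain Z d.+1.

Definition nilpotent (A : 'M[C]_n) := exists k, iter k (mulmx A) 1%:M = 0.
Definition Nvar : X -> Prop :=
  fun p => p.1 *m p.2 + p.2 *m p.1 = 0 /\ nilpotent p.1.

Definition is_partition (lam : seq nat) :=
  [/\ sorted geq lam, all (fun k => 0 < k)%N lam & sumn lam = n].

Definition block_starts (lam : seq nat) : seq nat :=
  [seq sumn (take k lam) | k <- iota 0 (size lam).+1].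

(* J_lam(0): block diagonal with nilpotent Jordan blocks of sizes
   lam_1, lam_2, ... (ones on the superdiagonal within each block) *)
Definition Jordan0 (lam : seq nat) : 'M[C]_n :=
  \matrix_(i, j) (if (j == i.+1 :> nat) && (i.+1 \notin block_starts lam)
                  then 1 else 0).

Definition orbits_lam (lam : seq nat) : X -> Prop :=
  fun p => exists (g : 'M[C]_n) (B : 'M[C]_n),
    [/\ g \in unitmx, Nvar (Jordan0 lam, B) &
        p = (g *m Jordan0 lam *m invmx g, g *m B *m invmx g)].

Definition Nlam (lam : seq nat) : X -> Prop := zclosure (orbits_lam lam).

End Defs.

(* Main.v *)
From Pilot Require Import Defs.
From HB Require Import structures.
From mathcomp Require Import all_boot all_order all_algebra.
From mathcomp Require Import reals complex.
From mathcomp Require Import perm boolp zify.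
Set Implicit Arguments. Unset Strict Implicit. Unset Printing Implicit Defensive.
Import Pilot.Defs Order.TTheory GRing.Theory Num.Theory.
Local Open Scope ring_scope.

(* If [S] is the diagonal sign matrix, then [S J = - J S] for [J] a Jordan
   matrix, so [B -> S B] turns the [B] anticommuting with [J] into the
   centralizer [z(J)].  Hence N_lam is the closure of an image of [GL_n * z(J)],
   an open subset of an affine space, and is irreducible.  Cutting [GL_n] by
   a linear complement of [z(J)] through 1 gives a birational parametrization
   of N_lam by an affine space of dimension [n ^ 2].

   The dimension is read off the growth of polynomial functions of bounded
   degree.  If Z' is a proper closed subset of an irreducible Z and [f]
   vanishes on Z' but not on Z, then multiplying by [f] shows that the number
   of independent functions of degree [<= m] grows by one more power of [m] on
   Z than on Z'; a chain of length [d] thus forces growth [C(m + d, d)], while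
   a parametrization by [D] variables allows only [O(m ^ D)].  Conversely the
   closures of the images of a coordinate flag form a chain, with distinct
   members because the parametrization has a rational inverse.

   Every nilpotent matrix has a Jordan form, so the N_lam cover N_n; they have
   equal dimension, so an inclusion between two of them is an equality, and
   then the ranks of the powers of [A] (lower semicontinuous) force the
   partitions to agree. *)

(** * Polynomial functions of bounded degree *)

Section PolynomialFunctions.
Variable F : numFieldType.

(** In characteristic zero the integers from 0 to [size p - 1] are distinct, one more than the
    largest possible number of roots. *)
Lemma poly_nonroot (p : {poly F}) : p != 0 -> exists t, p.[t] != 0.
Proof.
move=> p0; apply: contrapT => nt.
have /max_poly_roots := p0 => /(_ [seq i%:R | i <- iota 0 (size p)]).
rewrite size_map size_iota ltnn; move=> H; suff: false by []; apply: H.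
  apply/allP => x _; rewrite /root; apply: contrapT => /negP h.
  by apply: nt; exists x.
by rewrite map_inj_uniq ?iota_uniq //; apply: mulrIn; rewrite oner_eq0.
Qed.

(** The index only bounds the degree, because of [pdeg_weak]. With abstract coordinates [crd], one
    predicate serves pairs of matrices and the row vectors parametrizing them. *)
Inductive pdeg (I Y : Type) (crd : I -> Y -> F) : nat -> (Y -> F) -> Prop :=
| pdeg_const c : pdeg crd 0 (fun _ => c)
| pdeg_crd i : pdeg crd 1 (crd i)
| pdeg_add k f g : pdeg crd k f -> pdeg crd k g -> pdeg crd k (fun y => f y + g y)
| pdeg_mul k l f g :
    pdeg crd k f -> pdeg crd l g -> pdeg crd (k + l) (fun y => f y * g y)
| pdeg_weak k l f : (k <= l)%N -> pdeg crd k f -> pdeg crd l f.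

Definition regfun (I Y : Type) (crd : I -> Y -> F) f := exists k, pdeg crd k f.

Definition regmx (I Y : Type) (crd : I -> Y -> F) p q (M : Y -> 'M[F]_(p, q)) :=
  forall i j, regfun crd (fun y => M y i j).

Section Closure.
Variables (I Y : Type) (crd : I -> Y -> F).
Local Notation regfun := (regfun crd).
Local Notation regmx := (regmx crd).

Lemma regfun_ext f g : f =1 g -> regfun f -> regfun g.
Proof. by move=> /funext ->. Qed.

Lemma regfun_const c : regfun (fun _ => c).
Proof. by exists 0%N; apply: pdeg_const. Qed.

Lemma regfun_add f g : regfun f -> regfun g -> regfun (fun y => f y + g y).
Proof.
move=> [k hf] [l hg]; exists (k + l)%N; apply: pdeg_add.
  by apply: pdeg_weak hf; rewrite leq_addr.
by apply: pdeg_weak hg; rewrite leq_addl.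
Qed.

Lemma regfun_mul f g : regfun f -> regfun g -> regfun (fun y => f y * g y).
Proof. by move=> [k hf] [l hg]; exists (k + l)%N; apply: pdeg_mul. Qed.

Lemma regfun_sum (J : Type) (r : seq J) (f : J -> Y -> F) :
  (forall j, regfun (f j)) -> regfun (fun y => \sum_(j <- r) f j y).
Proof.
move=> hf; elim: r => [|j r IH].
  by apply: regfun_ext (regfun_const 0) => y; rewrite big_nil.
by apply: regfun_ext (regfun_add (hf j) IH) => y; rewrite big_cons.
Qed.

Lemma regfun_prod (J : Type) (r : seq J) (f : J -> Y -> F) :
  (forall j, regfun (f j)) -> regfun (fun y => \prod_(j <- r) f j y).
Proof.
move=> hf; elim: r => [|j r IH].
  by apply: regfun_ext (regfun_const 1) => y; rewrite big_nil.
by apply: regfun_ext (regfun_mul (hf j) IH) => y; rewrite big_cons.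
Qed.

Lemma regmx_const p q (M : 'M_(p, q)) : regmx (fun _ => M).
Proof. by move=> i j; apply: regfun_const. Qed.

Lemma regmx_mul p q s (M : Y -> 'M_(p, q)) (N : Y -> 'M_(q, s)) :
  regmx M -> regmx N -> regmx (fun y => M y *m N y).
Proof.
move=> hM hN i j; 
have h := regfun_sum (index_enum 'I_q) (fun k => regfun_mul (hM i k) (hN k j)).
by apply: regfun_ext h => y; rewrite mxE.
Qed.

Lemma regmx_add p q (M N : Y -> 'M_(p, q)) :
  regmx M -> regmx N -> regmx (fun y => M y + N y).
Proof.
move=> hM hN i j; apply: regfun_ext (regfun_add (hM i j) (hN i j)) => y.
by rewrite mxE.
Qed.

Lemma regmx_scale p q f (M : Y -> 'M_(p, q)) :
  regfun f -> regmx M -> regmx (fun y => f y *: M y).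
Proof.
move=> hf hM i j; apply: regfun_ext (regfun_mul hf (hM i j)) => y.
by rewrite mxE.
Qed.

Lemma regmx_opp p q (M : Y -> 'M_(p, q)) : regmx M -> regmx (fun y => - M y).
Proof.
move=> hM i j; apply: regfun_ext (regfun_mul (regfun_const (-1)) (hM i j)) => y.
by rewrite mxE mulN1r.
Qed.

Lemma regfun_det p (M : Y -> 'M_p) : regmx M -> regfun (fun y => \det (M y)).
Proof.
move=> hM.
have h (s : 'S_p) := regfun_mul (regfun_const ((-1) ^+ s))
  (regfun_prod (index_enum 'I_p) (fun i => hM i (s i))).
by apply: regfun_ext (regfun_sum (index_enum _) h) => y.
Qed.

Lemma regmx_adj p (M : Y -> 'M_p) : regmx M -> regmx (fun y => \adj (M y)).
Proof.
move=> hM i j.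
have h : regmx (fun y => row' j (col' i (M y))).
  by move=> a b; apply: regfun_ext (hM (lift j a) (lift i b)) => y; rewrite !mxE.
apply: regfun_ext (regfun_mul (regfun_const ((-1) ^+ (j + i))) (regfun_det h)) => y.
by rewrite mxE /cofactor.
Qed.

Lemma regmx_mxvec p q (M : Y -> 'M_(p, q)) : regmx M -> regmx (fun y => mxvec (M y)).
Proof.
move=> hM i j; case/mxvec_indexP: j => a b; apply: regfun_ext (hM a b) => y.
by rewrite (ord1 i) mxvecE.
Qed.

Lemma regmx_vec_mx p q (M : Y -> 'rV_(p * q)) : regmx M -> regmx (fun y => vec_mx (M y)).
Proof.
move=> hM i j; apply: regfun_ext (hM 0 (mxvec_index i j)) => y.
by rewrite mxE.
Qed.

Lemma regmx_row_mx p q s (M : Y -> 'M_(p, q)) (N : Y -> 'M_(p, s)) :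
  regmx M -> regmx N -> regmx (fun y => row_mx (M y) (N y)).
Proof.
move=> hM hN i j; case: (split_ordP j) => k ->.
  by apply: regfun_ext (hM i k) => y; rewrite row_mxEl.
by apply: regfun_ext (hN i k) => y; rewrite row_mxEr.
Qed.

Lemma regmx_lin_mulmx p q s (M : Y -> 'M_(p, q)) :
  regmx M -> regmx (fun y => lin_mulmx (M y) : 'M_(q * s, p * s)).
Proof.
move=> hM i j.
have h := regmx_mxvec (regmx_mul hM (@regmx_const _ s (vec_mx (delta_mx 0 i)))).
by apply: regfun_ext (h 0 j) => y; rewrite [RHS]mxE.
Qed.

End Closure.

(** * Polynomial functions on an affine space *)

Definition rvcrd D (i : 'I_D) (y : 'rV[F]_D) : F := y 0 i.

Lemma regmx_lsubmx a b : regmx (@rvcrd (a + b)) (@lsubmx F 1 a b).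
Proof.
by move=> i j; exists 1%N; have := pdeg_crd (@rvcrd (a + b)) (lshift b j);
  congr pdeg; apply: funext => y; rewrite /rvcrd (ord1 i) mxE.
Qed.

Lemma regmx_rsubmx a b : regmx (@rvcrd (a + b)) (@rsubmx F 1 a b).
Proof.
by move=> i j; exists 1%N; have := pdeg_crd (@rvcrd (a + b)) (rshift a j);
  congr pdeg; apply: funext => y; rewrite /rvcrd (ord1 i) mxE.
Qed.

Lemma regfun_comp D D' (g : 'rV[F]_D -> 'rV[F]_D') f :
  regmx (@rvcrd D) g -> regfun (@rvcrd D') f -> regfun (@rvcrd D) (f \o g).
Proof.
move=> hg [k]; elim=> [c|i|l f1 f2 _ h1 _ h2|l l' f1 f2 _ h1 _ h2|//].
- exact: regfun_const.
- exact: hg.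
- exact: regfun_add.
- exact: regfun_mul.
Qed.

Lemma regfun_line D f (y z : 'rV[F]_D) : regfun (@rvcrd D) f ->
  exists q : {poly F}, forall t, f (y + t *: (z - y)) = q.[t].
Proof.
case=> k; elim=> [c|i|l f1 f2 _ [p hp] _ [q hq]|l l' f1 f2 _ [p hp] _ [q hq]|//].
- by exists c%:P => t; rewrite hornerC.
- exists ((y 0 i)%:P + (z 0 i - y 0 i) *: 'X) => t.
  by rewrite /rvcrd !hornerE !mxE mulrC.
- by exists (p + q) => t; rewrite hornerD hp hq.
- by exists (p * q) => t; rewrite hornerM hp hq.
Qed.

(* Two nonzero polynomials restricted to the line through [y] and [z] are
   nonzero univariate polynomials, hence have a common nonroot. *)
Lemma regfun_common_nonzero D f g (y z : 'rV[F]_D) :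
  regfun (@rvcrd D) f -> regfun (@rvcrd D) g -> f y != 0 -> g z != 0 ->
  exists x, f x != 0 /\ g x != 0.
Proof.
move=> hf hg fy gz.
have [p hp] := regfun_line y z hf; have [q hq] := regfun_line y z hg.
have p0 : p != 0.
  by apply: contraNneq fy => p0; rewrite -[y]addr0 -(scale0r (z - y)) hp p0 horner0.
have q0 : q != 0.
  apply: contraNneq gz => q0; have := hq 1.
  by rewrite q0 horner0 scale1r addrC subrK => ->.
have [t ht] := poly_nonroot (mulf_neq0 p0 q0).
exists (y + t *: (z - y)); rewrite hp hq.
by move: ht; rewrite hornerM mulf_eq0 negb_or => /andP[].
Qed.

Lemma regfun_uniform (I Y : Type) (J : finType) (crd : I -> Y -> F) (f : J -> Y -> F) :
  (forall j, regfun crd (f j)) -> exists k, forall j, pdeg crd k (f j).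
Proof.
move=> /choice[k hk]; exists (\max_j k j)%N => j.
by apply: pdeg_weak (hk j); apply: leq_bigmax.
Qed.

Lemma pdeg_exp (I Y : Type) (crd : I -> Y -> F) k m f :
  pdeg crd k f -> pdeg crd (k * m) (fun y => f y ^+ m).
Proof.
move=> hf; elim: m => [|m IH].
  by rewrite muln0; have := pdeg_const crd 1; congr pdeg;
    apply: funext => y; rewrite expr0.
rewrite mulnS; have := pdeg_mul hf IH; congr pdeg; apply: funext => y.
by rewrite exprS.
Qed.

(** Exponents are bounded one by one, not through the total degree: there are [k.+1 ^ D] exponent
    vectors, and this crude count suffices for comparing growth. *)
Definition monom D k (s : {ffun 'I_D -> 'I_k.+1}) (y : 'rV[F]_D) : F :=
  \prod_i y 0 i ^+ s i.

Definition monom_span D k (f : 'rV[F]_D -> F) :=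
  exists c : {ffun 'I_D -> 'I_k.+1} -> F, forall y, f y = \sum_s c s * monom s y.

Lemma monom_span_sum D k (J : finType) (f : J -> 'rV[F]_D -> F) :
  (forall j, monom_span k (f j)) -> monom_span k (fun y => \sum_j f j y).
Proof.
move=> /choice[c hc]; exists (fun s => \sum_j c j s) => y.
under [RHS]eq_bigr do rewrite mulr_suml.
by rewrite exchange_big; apply: eq_bigr => j _; apply: hc.
Qed.

Lemma monom_span_monom D k (a : F) (s : 'I_D -> nat) : (forall i, (s i <= k)%N) ->
  monom_span k (fun y => a * \prod_i y 0 i ^+ s i).
Proof.
move=> hs; pose s' : {ffun 'I_D -> 'I_k.+1} := [ffun i => inord (s i)].
exists (fun r => if r == s' then a else 0) => y.
rewrite (bigD1 s') //= eqxx [X in _ + X]big1 => [|r /negbTE ->]; last by rewrite mul0r.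
rewrite addr0; congr (_ * _); apply: eq_bigr => i _.
by rewrite ffunE inordK // ltnS.
Qed.

Lemma pdeg_monom_span D k f : pdeg (@rvcrd D) k f -> monom_span k f.
Proof.
elim=> [c|i|l f1 f2 _ [c1 h1] _ [c2 h2]|l l' f1 f2 _ [c1 h1] _ [c2 h2]|l l' g hl _ [c hc]].
- have := @monom_span_monom D 0 c (fun _ => 0%N) (fun=> leqnn 0); congr monom_span.
  by apply: funext => y; rewrite big1 ?mulr1 // => i _; rewrite expr0.
- have := @monom_span_monom D 1 1 (fun j => nat_of_bool (j == i))
    (fun j => leq_b1 (j == i)).
  congr monom_span; apply: funext => y; rewrite mul1r (bigD1 i) //= eqxx expr1.
  by rewrite big1 ?mulr1 // => j /negbTE ->.
- exists (fun s => c1 s + c2 s) => y; rewrite h1 h2 -big_split /=.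
  by apply: eq_bigr => s _; rewrite mulrDl.
- have := @monom_span_sum D (l + l') _ (fun (s : _ * _) y =>
     (c1 s.1 * c2 s.2) * \prod_i y 0 i ^+ (s.1 i + s.2 i)%N).
  move=> /(_ (fun s => monom_span_monom _ _)) h.
  have /h : forall (s : {ffun 'I_D -> 'I_l.+1} * {ffun 'I_D -> 'I_l'.+1}) i,
      (s.1 i + s.2 i <= l + l')%N.
    by move=> s i; apply: leq_add; rewrite -ltnS ltn_ord.
  congr monom_span; apply: funext => y; rewrite h1 h2 big_distrlr /=.
  rewrite pair_big /=; apply: eq_bigr => s _.
  rewrite mulrACA; congr (_ * _); rewrite /monom -big_split /=.
  by apply: eq_bigr => i _; rewrite exprD.
- have := monom_span_sum (fun s => @monom_span_monom D l' (c s) (fun i => s i) _).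
  have hs (s : {ffun 'I_D -> 'I_l.+1}) i : (s i <= l')%N.
    by apply: leq_trans hl; rewrite -ltnS.
  by move=> /(_ hs); congr monom_span; apply: funext => y; rewrite hc.
Qed.

(** Row [i] of [M] holds the coefficients of [f i]. Having more rows than there are monomials, [M]
    has a nonzero left kernel vector, which is a linear relation. *)
Lemma pdeg_dependent D k N (f : 'I_N -> 'rV[F]_D -> F) :
  (forall i, pdeg (@rvcrd D) k (f i)) -> (k.+1 ^ D < N)%N ->
  exists c : 'rV[F]_N, c != 0 /\ forall y, \sum_i c 0 i * f i y = 0.
Proof.
move=> hf hN.
have /choice[c hc] := fun i => pdeg_monom_span (hf i).
pose M : 'M[F]_(N, #|{: {ffun 'I_D -> 'I_k.+1}}|) := \matrix_(i, j) c i (enum_val j).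
have hM : \rank (kermx M) != 0%N.
  rewrite mxrank_ker subn_eq0 -ltnNge; apply: leq_ltn_trans (rank_leq_col _) _.
  by rewrite card_ffun !card_ord.
exists (nz_row (kermx M)); split; first by rewrite nz_row_eq0 -mxrank_eq0.
set v := nz_row _ => y.
have : v *m M = 0 by apply/eqP; rewrite -sub_kermx nz_row_sub.
move=> vM; under eq_bigr do rewrite hc mulr_sumr.
rewrite exchange_big /= big1 // => s _.
have {vM} := congr1 (fun B : 'rV_ _ => B 0 (enum_rank s)) vM.
rewrite [LHS]mxE [RHS]mxE => vM.
under eq_bigr do rewrite mulrA.
rewrite -mulr_suml; suff -> : \sum_i v 0 i * c i s = 0 by rewrite mul0r.
by rewrite -[RHS]vM; apply: eq_bigr => i _; rewrite mxE enum_rankK.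
Qed.

End PolynomialFunctions.

(** * Irreducibility and chains of closed sets *)

Lemma choice2 T U (P Q : T -> U -> Prop) : (forall x, exists2 y, P x y & Q x y) ->
  exists2 f, forall x, P x (f x) & forall x, Q x (f x).
Proof.
move=> h; have /choice[f hf] : forall x, exists y, P x y /\ Q x y.
  by move=> x; have [y] := h x; exists y.
by exists f => x; have [] := hf x.
Qed.

Section Zariski.
Variables (R : realType) (n : nat).
Local Notation C := (complex R).
Local Notation X := ('M[C]_n * 'M[C]_n)%type.
Implicit Types (A B Z : X -> Prop) (f : X -> C).

(** The index type is finite, so that one degree bound can be taken over the entries of both
    matrices. *)
Definition Xcrd (c : bool * ('I_n * 'I_n)) (p : X) : C :=
  if c.1 then p.1 c.2.1 c.2.2 else p.2 c.2.1 c.2.2.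

Lemma polyfunP f : polyfun f <-> regfun Xcrd f.
Proof.
split; first elim=> [c|i j|i j|g h _ hg _ hh|g h _ hg _ hh]; last first.
  case=> k; elim=> [c|[b [i j]]|l g h _ hg _ hh|l l' g h _ hg _ hh|] //.
  - exact: pf_const.
  - by case: b; [apply: pf_coordA|apply: pf_coordB].
  - exact: pf_add.
  - exact: pf_mul.
- exact: regfun_mul.
- exact: regfun_add.
- by exists 1%N; apply: (pdeg_crd Xcrd (false, (i, j))).
- by exists 1%N; apply: (pdeg_crd Xcrd (true, (i, j))).
- exact: regfun_const.
Qed.

Lemma regmx_fst : regmx Xcrd (fun p : X => p.1).
Proof. by move=> i j; apply/polyfunP; apply: pf_coordA. Qed.

Lemma regmx_snd : regmx Xcrd (fun p : X => p.2).
Proof. by move=> i j; apply/polyfunP; apply: pf_coordB. Qed.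

Lemma seteq_eq A B : seteq A B -> A = B.
Proof. by move=> h; apply: funext => x; apply: propext. Qed.

Lemma zclosed_zeros f : polyfun f -> zclosed (fun x => f x = 0).
Proof.
move=> hf; exists (fun g => g = f); split=> [g ->|x] //.
by split=> [fx g ->|/(_ f erefl)].
Qed.

Lemma zclosed_regmx p q (M : X -> 'M[C]_(p, q)) :
  regmx Xcrd M -> zclosed (fun x => M x = 0).
Proof.
move=> hM; exists (fun g => exists i j, g = fun x => M x i j); split.
  by move=> _ [i [j ->]]; apply/polyfunP.
move=> x; split=> [Mx _ [i [j ->]]|h]; first by rewrite Mx mxE.
by apply/matrixP => i j; rewrite mxE (h (fun x => M x i j)) //; exists i, j.
Qed.

Lemma zclosedI A B : zclosed A -> zclosed B -> zclosed (fun x => A x /\ B x).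
Proof.
move=> [S [hS SA]] [T [hT TB]]; exists (fun f => S f \/ T f); split.
  by move=> f [/hS|/hT].
move=> x; rewrite SA TB; split=> [[h1 h2] f [/h1|/h2]|h] //.
by split=> f hf; apply: h; [left|right].
Qed.

(** Closed sets are intersections of zero loci of single functions, so these alone decide the
    closure. *)
Lemma zclosureP A x :
  zclosure A x <-> forall f, polyfun f -> (forall a, A a -> f a = 0) -> f x = 0.
Proof.
split=> [h f hf fA|h Z [S [hS SZ]] AZ].
  by apply: (h (fun x => f x = 0)) => //; apply: zclosed_zeros.
by apply/SZ => f Sf; apply: h (hS _ Sf) _ => a /AZ /SZ; apply.
Qed.

Lemma zclosed_zclosure A : zclosed (zclosure A).
Proof.
exists (fun f => polyfun f /\ forall a, A a -> f a = 0); split=> [f []//|x].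
rewrite zclosureP; split=> [h f [hf fA]|h f hf fA]; first exact: h.
exact: h.
Qed.

Lemma sub_zclosure A : subset A (zclosure A).
Proof. by move=> x Ax Z _; apply. Qed.

Lemma zclosure_min A Z : zclosed Z -> subset A Z -> subset (zclosure A) Z.
Proof. by move=> hZ AZ x; apply. Qed.

Lemma zclosed_separate A Z : zclosed Z -> ~ subset A Z ->
  exists f x, [/\ polyfun f, forall z, Z z -> f z = 0, A x & f x != 0].
Proof.
move=> [S [hS SZ]] /existsNP[x /not_implyP[Ax nZx]].
have /existsNP[f /not_implyP[Sf fx]] : ~ forall f, S f -> f x = 0 by rewrite -SZ.
exists f, x; split=> //; [exact: hS|by move=> z /SZ; apply|exact/eqP].
Qed.

Lemma irreducible_mul_eq0 Z f g : irreducible Z -> polyfun f -> polyfun g ->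
  (forall x, Z x -> f x * g x = 0) ->
  (forall x, Z x -> f x = 0) \/ (forall x, Z x -> g x = 0).
Proof.
move=> [_ hZ] hf hg fg; apply: hZ; [exact: zclosed_zeros|exact: zclosed_zeros|].
by move=> x /fg /eqP; rewrite mulf_eq0 => /orP[]/eqP; [left|right].
Qed.

Lemma irreducible_cover (I : eqType) (s : seq I) (Y : I -> X -> Prop) W :
  irreducible W -> (forall i, zclosed (Y i)) ->
  (forall x, W x -> exists2 i, i \in s & Y i x) ->
  exists2 i, i \in s & subset W (Y i).
Proof.
move=> [[w Ww] hW] hY; elim: s => [|i s IH] hs; first by have [] := hs w Ww.
have [h|h] := pselect (subset W (Y i)); first by exists i; rewrite ?inE ?eqxx.
suff hUs : exists2 j, j \in s & subset W (Y j).
  by have [j js hj] := hUs; exists j; rewrite ?inE ?js ?orbT.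
apply: contrapT => nh.
(* A finite union is closed: products of equations cut out a union of two sets, and the constant 1
   cuts out the empty union. *)
have hU : zclosed (fun x => exists2 j, j \in s & Y j x).
  elim: s {IH hs nh} => [|j s [S [hS SE]]].
    exists (fun f => f = fun _ => 1); split=> [_ ->|x]; first exact: pf_const.
    by split=> [[]//|/(_ _ erefl)/eqP]; rewrite oner_eq0.
  have [T [hT TE]] := hY j.
  exists (fun h => exists f g, [/\ T f, S g & h = fun x => f x * g x]); split.
    by move=> _ [f [g [/hT ? /hS ? ->]]]; apply: pf_mul.
  move=> x; split=> [[l]|hx].
    rewrite inE => /orP[/eqP ->|ls] Yl _ [f [g [Tf Sg ->]]].
      by rewrite (TE x).1 ?mul0r.
    by rewrite [g x](SE x).1 ?mulr0 //; exists l.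
  have [/(TE x) Yj|] := pselect (forall f, T f -> f x = 0).
    by exists j; rewrite ?inE ?eqxx.
  move=> /existsNP[f /not_implyP[Tf fx]].
  have /(SE x)[l ls Yl] : forall g, S g -> g x = 0.
    move=> g Sg; have /eqP : f x * g x = 0 by apply: (hx (fun x => _)); exists f, g.
    by rewrite mulf_eq0 => /orP[]/eqP.
  by exists l; rewrite ?inE ?ls ?orbT.
have [x|//|hs'] := hW _ _ (hY i) hU.
  by move=> /hs[j]; rewrite inE => /orP[/eqP ->|js] Yj; [left|right; exists j].
by apply: nh; apply: IH => x /hs'.
Qed.

(** * Closures of images of rational maps from affine space *)

Section RationalMap.
Variables (D : nat) (d : 'rV[C]_D -> C) (phi : 'rV[C]_D -> X).

(** The total function [phi] counts as rational when [d] clears the denominators of its coordinates;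
    its values where [d] vanishes are ignored. *)
Definition ratmap := regfun (@rvcrd C D) d /\ forall c, exists2 p, regfun (@rvcrd C D) p &
  forall y, d y != 0 -> p y = d y * Xcrd c (phi y).

Definition ratimage (x : X) := exists2 y, d y != 0 & x = phi y.

Hypothesis phi_rat : ratmap.

Lemma ratmap_pullback : exists e, forall m f, pdeg Xcrd m f ->
  exists2 p, pdeg (@rvcrd C D) (e * m) p &
    forall y, d y != 0 -> p y = d y ^+ m * f (phi y).
Proof.
have [hd /choice2 [p hp hpE]] := phi_rat.
have [e he] : exists e, forall c, pdeg (@rvcrd C D) e (if c is Some c then p c else d).
  by apply: regfun_uniform => -[].
exists e => m f; elim=> {m f} [c|c|k f g _ [a ha1 ha2] _ [b hb1 hb2]
  |k l f g _ [a ha1 ha2] _ [b hb1 hb2]|k l f kl _ [a ha1 ha2]].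
- exists (fun _ => c); first by rewrite muln0; apply: pdeg_const.
  by move=> y _; rewrite expr0 mul1r.
- by exists (p c) => [|y dy]; rewrite ?muln1 ?expr1; [exact: (he (Some c))|exact: hpE].
- exists (fun y => a y + b y) => [|y dy]; first exact: pdeg_add.
  by rewrite ha2 // hb2 // mulrDr.
- exists (fun y => a y * b y) => [|y dy]; first by rewrite mulnDr; apply: pdeg_mul.
  by rewrite ha2 // hb2 // exprD mulrACA.
(* Raising the bound from [k] to [l] costs [l - k] further factors [d], since the power of [d]
   follows the bound. *)
- exists (fun y => d y ^+ (l - k) * a y) => [|y dy].
    rewrite -{1}(subnK kl) mulnDr; apply: pdeg_mul => //.
    exact/pdeg_exp/(he None).
  by rewrite ha2 // mulrA -exprD subnK.
Qed.

Lemma ratmap_polyfun f : polyfun f -> exists m, exists2 p, regfun (@rvcrd C D) p &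
  forall y, d y != 0 -> p y = d y ^+ m * f (phi y).
Proof.
move=> /polyfunP[m hf]; have [e he] := ratmap_pullback.
by have [p hp hpE] := he m f hf; exists m, p => //; exists (e * m)%N.
Qed.

(** If neither closed set contained the image, functions vanishing on each would pull back to
    nonzero polynomials with a common nonroot; the extra factor [d] keeps that point in the
    domain. *)
Lemma irreducible_ratimage : (exists y, d y != 0) -> irreducible (zclosure ratimage).
Proof.
move=> [y0 dy0]; split; first by exists (phi y0); apply: sub_zclosure; exists y0.
move=> Z1 Z2 c1 c2 h; apply: contrapT => /not_orP[n1 n2].
have [f1 [_ [hf1 f1Z [y1 dy1 ->] f1y]]] :=
  zclosed_separate c1 (fun h => n1 (zclosure_min c1 h)).
have [f2 [_ [hf2 f2Z [y2 dy2 ->] f2y]]] :=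
  zclosed_separate c2 (fun h => n2 (zclosure_min c2 h)).
have [m1 [p1 hp1 p1E]] := ratmap_polyfun hf1.
have [m2 [p2 hp2 p2E]] := ratmap_polyfun hf2.
have [y []] : exists y, p1 y * d y != 0 /\ p2 y != 0.
  apply: (@regfun_common_nonzero _ _ (fun y => p1 y * d y) p2 y1 y2) => //.
  - by apply: regfun_mul => //; case: phi_rat.
  - by rewrite p1E // !mulf_neq0 ?expf_neq0.
  - by rewrite p2E // !mulf_neq0 ?expf_neq0.
rewrite mulf_eq0 negb_or => /andP[p1y dy]; rewrite p2E // => p2y.
rewrite p1E // in p1y.
have [/f1Z e|/f2Z e] : Z1 (phi y) \/ Z2 (phi y).
- by apply: h; apply: sub_zclosure; exists y.
- by rewrite e mulr0 eqxx in p1y.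
- by rewrite e mulr0 eqxx in p2y.
Qed.

End RationalMap.

Lemma ratmap_comp D D' (d : 'rV[C]_D' -> C) phi (g : 'rV[C]_D -> 'rV[C]_D') :
  ratmap d phi -> regmx (@rvcrd C D) g -> ratmap (d \o g) (phi \o g).
Proof.
move=> [hd hphi] hg; split=> [|c]; first exact: regfun_comp.
have [p hp pE] := hphi c; exists (p \o g); first exact: regfun_comp.
by move=> y dy; apply: pE.
Qed.

(** This says that the affine Hilbert function of [Z] at [m] is at least [N]. *)
Definition indep Z m N := exists2 f : 'I_N -> X -> C, (forall i, pdeg Xcrd m (f i)) &
  forall c : 'rV[C]_N, (forall x, Z x -> \sum_i c 0 i * f i x = 0) -> c = 0.

Lemma indep_sub Z Z' m m' N : subset Z Z' -> (m <= m')%N -> indep Z m N -> indep Z' m' N.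
Proof.
move=> ZZ mm [f hf fi]; exists f => [i|c h]; first by apply: pdeg_weak (hf i).
by apply: fi => x /ZZ; apply: h.
Qed.

Lemma indep1 Z m : (exists x, Z x) -> indep Z m 1.
Proof.
move=> [x Zx]; exists (fun _ _ => 1) => [i|c /(_ x Zx)].
  by apply: pdeg_weak (pdeg_const _ _).
by rewrite big_ord1 mulr1 => h; apply/rowP => i; rewrite ord1 h mxE.
Qed.

(** Restricting a relation to [Z'] kills the multiples of [f], so the coefficients of the [u]
    vanish. What remains is [f] times a function, and irreducibility of [Z] cancels [f]. *)
Lemma indep_psubset Z' Z e f k M N : irreducible Z -> subset Z' Z ->
  pdeg Xcrd e f -> (forall x, Z' x -> f x = 0) -> ~ (forall x, Z x -> f x = 0) ->
  indep Z' (e + k) N -> indep Z k M -> indep Z (e + k) (N + M).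
Proof.
move=> irr ZZ hf fZ' fZ [u hu ui] [v hv vi].
exists (fun i x => match split i with inl a => u a x | inr b => f x * v b x end).
  by move=> i; case: (split i) => [a|b]; [exact: hu|apply: pdeg_mul].
move=> c hc.
have hc' x : Z x -> \sum_i lsubmx c 0 i * u i x + f x * (\sum_i rsubmx c 0 i * v i x) = 0.
  move=> /hc e0; rewrite -[RHS]e0 big_split_ord /= mulr_sumr.
  congr (_ + _); apply: eq_bigr => i _.
    by rewrite -[lshift _ _]/(unsplit (inl i)) unsplitK mxE.
  by rewrite -[rshift _ _]/(unsplit (inr i)) unsplitK mxE mulrCA.
have cl : lsubmx c = 0.
  by apply: ui => x Zx; have := hc' x (ZZ x Zx); rewrite fZ' // mul0r addr0.
have cr : rsubmx c = 0.
  pose g x := \sum_i rsubmx c 0 i * v i x.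
  have hg : polyfun g.
    apply/polyfunP; apply: regfun_sum => i; apply: regfun_mul; first exact: regfun_const.
    by exists k.
  have fg x : Z x -> f x * g x = 0.
    move=> /hc' e0; rewrite -[RHS]e0 cl big1 ?add0r // => i _.
    by rewrite mxE mul0r.
  have hf' : polyfun f by apply/polyfunP; exists e.
  by apply: vi; have [/fZ|] := irreducible_mul_eq0 irr hf' hg fg.
by rewrite -[c]hsubmxK cl cr row_mx0.
Qed.

(** Double induction on [d] and [m] along Pascal's rule, each step being an instance of
    [indep_psubset]. The slope [e' + e] absorbs the degree of the function [f] separating two
    members of the chain. *)
Lemma chain_growth (Fc : nat -> X -> Prop) d :
  (forall i, (i <= d)%N -> zclosed (Fc i) /\ irreducible (Fc i)) ->
  (forall i, (i < d)%N -> psubset (Fc i) (Fc i.+1)) ->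
  exists e, forall m, indep (Fc d) (e * m) 'C(m + d, d).
Proof.
elim: d => [|d IH] h1 h2.
  exists 0%N => m; rewrite bin0; apply: indep1.
  by have [_ []] := h1 0%N isT.
have [i hi|i hi|e he] := IH; [by apply/h1/leqW|by apply/h2/leqW|].
have [sub nsub] := h2 d (ltnSn d).
have [cl _] := h1 d (leqnSn d); have [_ irr] := h1 d.+1 (leqnn _).
have [f [x [/polyfunP[e' hf] fZ Zx fx]]] := zclosed_separate cl nsub.
exists (e' + e)%N; elim=> [|m IHm].
  by rewrite binn; apply: indep1; case: irr.
have -> : 'C(m.+1 + d.+1, d.+1) = ('C(m.+1 + d, d) + 'C(m + d.+1, d.+1))%N.
  by rewrite addnS binS addnC addSnnS.
rewrite mulnS.
have fnz : ~ forall x, Fc d.+1 x -> f x = 0 by move=> /(_ x Zx)/eqP; rewrite (negbTE fx).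
have hf' : pdeg Xcrd (e' + e) f by apply: pdeg_weak hf; rewrite leq_addr.
apply: (indep_psubset irr sub hf' fZ fnz _ IHm).
apply: indep_sub (he m.+1); first by [].
by rewrite -mulnS leq_mul2r leq_addl orbT.
Qed.

Lemma exp_lt_bin c D : exists m, ((c * m).+1 ^ D < 'C(m + D.+1, D.+1))%N.
Proof.
have ffact_lower m k : (m.+1 ^ k <= (m + k) ^_ k)%N.
  elim: k => [|k IH]; first by rewrite ffactn0.
  by rewrite addnS ffactSS expnS leq_mul // ltnS leq_addr.
(* Since [c m + 1 <= (c + 1) (m + 1)], this [m] makes [(c m + 1)^D (D + 1)!] at most [m (m + 1)^D],
   which is below [(m + 1)^(D + 1)]. *)
pose m := (c.+1 ^ D * (D.+1)`!)%N; exists m.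
rewrite -(ltn_pmul2r (fact_gt0 D.+1)) bin_ffact.
apply: leq_trans (ffact_lower m D.+1); rewrite expnS.
apply: (@leq_ltn_trans (m * m.+1 ^ D)); last by rewrite ltn_pmul2r ?expn_gt0.
rewrite {2}/m mulnAC leq_mul2r -expnMn; apply/orP; right.
by case: (D) => // k; rewrite leq_exp2r // mulSn mulnS; lia.
Qed.

(** A chain of length [D + 1] would give more independent functions than polynomials in [D]
    variables allow. A relation between their pullbacks holds on the image after cancelling a power
    of [d], hence on [Z] by density. *)
Lemma chain_upper_bound D (d : 'rV[C]_D -> C) phi Z : ratmap d phi ->
  (forall f, polyfun f -> (forall x, ratimage d phi x -> f x = 0) ->
     forall x, Z x -> f x = 0) ->
  ~ has_chain Z D.+1.
Proof.
move=> hphi dense [Fc [h1 h2]].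
have [e he] : exists e, forall m, indep (Fc D.+1) (e * m) 'C(m + D.+1, D.+1).
  by apply: chain_growth => // i /h1[].
have [e' he'] := ratmap_pullback hphi.
have [m hm] := exp_lt_bin (e' * e) D.
have {he}[f hf fi] := he m.
have /choice2[p hp pE] := fun i => he' _ _ (hf i).
rewrite -mulnA in hm.
have [c [c0 hc]] := pdeg_dependent hp hm.
case/eqP: c0; apply: fi => x Fx.
apply: (dense (fun x => \sum_i c 0 i * f i x)).
- apply/polyfunP; apply: regfun_sum => i; apply: regfun_mul; first exact: regfun_const.
  by exists (e * m)%N.
- move=> _ [y dy ->]; apply: (mulfI (expf_neq0 (e * m) dy)).
  by rewrite mulr0 -[RHS](hc y) mulr_sumr; apply: eq_bigr => i _; rewrite pE // mulrCA.
- by have [_ _] := h1 _ (leqnn _); apply.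
Qed.

(** The quotients [psi i / del] form a rational inverse of [phi]. The chain consists of the closures
    of the images of the subspaces spanned by the first [k] coordinates, and [psi] at index [k]
    tells member [k] from the next one. *)
Lemma chain_exists D (d : 'rV[C]_D -> C) phi Z (psi : 'I_D -> X -> C) del :
  ratmap d phi -> zclosed Z -> subset (ratimage d phi) Z ->
  (forall i, polyfun (psi i)) -> polyfun del ->
  (forall i y, d y != 0 -> psi i (phi y) = y 0 i * del (phi y)) ->
  d 0 != 0 -> del (phi 0) != 0 -> has_chain Z D.
Proof.
move=> hphi hZ imZ hpsi hdel psiE d0 del0.
pose pr k (y : 'rV[C]_D) : 'rV[C]_D := \row_i (if (i < k)%N then y 0 i else 0).
have pr_poly k : regmx (@rvcrd C D) (pr k).
  move=> i j; case: (ltnP j k) => hj.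
    exists 1%N; have := pdeg_crd (@rvcrd C D) j; congr pdeg; apply: funext => y.
    by rewrite mxE hj.
  by apply: regfun_ext (regfun_const _ 0) => y; rewrite mxE ltnNge hj.
have pr0 k : pr k 0 = 0 by apply/rowP => i; rewrite !mxE if_same.
have rat k : ratmap (d \o pr k) (phi \o pr k) by apply: ratmap_comp.
exists (fun k => zclosure (ratimage (d \o pr k) (phi \o pr k))); split=> [k _|k kD].
  split; [exact: zclosed_zclosure| |].
    by apply: irreducible_ratimage => //; exists 0; rewrite /= pr0.
  by apply: zclosure_min => // _ [y dy ->]; apply: imZ; exists (pr k y).
split=> [|h].
  apply: zclosure_min; first exact: zclosed_zclosure.
  move=> _ [y dy ->]; apply: sub_zclosure; exists (pr k y).
    rewrite /= (_ : pr k.+1 _ = pr k y) //; apply/rowP => i; rewrite !mxE.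
    by case: (ltnP i k) => hi; [rewrite ltnW|rewrite if_same].
  rewrite /=; congr phi; apply/rowP => i; rewrite !mxE.
  by case: (ltnP i k) => hi; [rewrite ltnW|rewrite if_same].
pose i := Ordinal kD.
have hk : subset (zclosure (ratimage (d \o pr k) (phi \o pr k))) (fun x => psi i x = 0).
  apply: zclosure_min; first exact: zclosed_zeros.
  by move=> _ [y dy ->]; rewrite psiE // mxE ltnn mul0r.
have [m [p hp pE]] := ratmap_polyfun hphi hdel.
(* The pullback [p] of [del] and [d] itself are nonzero at 0, and coordinate [i] at a unit vector,
   so some point of the next subspace avoids all three zero sets; [psi i] is nonzero there. *)
have [y []] : exists y, (p \o pr k.+1) y * (d \o pr k.+1) y != 0 /\ y 0 i != 0.
  apply: (@regfun_common_nonzero _ _ (fun y => (p \o pr k.+1) y * (d \o pr k.+1) y)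
    (fun y => y 0 i) 0 (delta_mx 0 i)).
  - by apply: regfun_mul; apply: regfun_comp => //; case: hphi.
  - by exists 1%N; apply: (pdeg_crd (@rvcrd C D) i).
  - by rewrite /= pr0 pE // !mulf_neq0 ?expf_neq0.
  - by rewrite mxE !eqxx oner_eq0.
rewrite mulf_eq0 negb_or /= => /andP[py dy] yi; rewrite pE // in py.
have /h/hk : zclosure (ratimage (d \o pr k.+1) (phi \o pr k.+1)) (phi (pr k.+1 y)).
  by apply: sub_zclosure; exists y.
rewrite psiE // mxE ltnSn => /eqP; rewrite mulf_eq0 (negbTE yi) /= => /eqP e.
by rewrite e mulr0 eqxx in py.
Qed.

End Zariski.

(** * Jordan form of nilpotent matrices *)

Lemma col_mul (F : pzSemiRingType) m n p (j : 'I_p) (A : 'M[F]_(m, n)) (B : 'M_(n, p)) :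
  col j (A *m B) = A *m col j B.
Proof. by rewrite !colE mulmxA. Qed.

Section JordanForm.
Variable R : realType.
Local Notation C := (complex R).
Local Notation J := (@Jordan0 R).

Lemma block_starts_nil : block_starts [::] = [:: 0%N].
Proof. by []. Qed.

Lemma block_starts_cons a lam :
  block_starts (a :: lam) = 0%N :: [seq (a + s)%N | s <- block_starts lam].
Proof.
have -> : block_starts (a :: lam) =
    [seq sumn (take k (a :: lam)) | k <- 0%N :: map (addn 1) (iota 0 (size lam).+1)].
  by rewrite -iotaDl.
by rewrite map_cons -!map_comp.
Qed.

Lemma block_starts0 lam : 0%N \in block_starts lam.
Proof. by case: lam => [|a lam]; rewrite ?block_starts_cons // inE eqxx. Qed.

Lemma Jordan0_cons a m lam :
  J (a + m) (a :: lam) = block_mx (J a [:: a]) 0 0 (J m lam).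
Proof.
apply/matrixP => i j; rewrite [LHS]mxE block_starts_cons.
have [bs Ebs] : exists bs, bs = block_starts lam by exists (block_starts lam).
have h0 : 0%N \in bs by rewrite Ebs block_starts0.
rewrite -Ebs.
case: (split_ordP i) => i' ->; case: (split_ordP j) => j' ->.
- rewrite block_mxEul mxE block_starts_cons block_starts_nil.
  congr (if _ && ~~ _ then _ else _); rewrite /= !inE /= addn0.
  apply/idP/eqP => [/mapP[s _ hs]|h].
    by have := ltn_ord i'; lia.
  by apply/mapP; exists 0%N; rewrite ?addn0.
- rewrite block_mxEur mxE; case: eqP => //= h.
  (* The only superdiagonal position in this corner is the junction of two Jordan blocks, where [a]
     is a block start. *)
  suff -> : i'.+1 = (a + 0)%N by rewrite inE map_f ?orbT.
  by have := ltn_ord i'; lia.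
- rewrite block_mxEdl mxE; case: eqP => //= h.
  by have := ltn_ord j'; lia.
- rewrite block_mxEdr mxE -Ebs /=.
  rewrite -addnS eqn_add2l; congr (if _ && ~~ _ then _ else _).
  by rewrite inE addnS /= -addnS mem_map // => x y /addnI.
Qed.

Lemma Jordan0_upper n lam k (i j : 'I_n) : (j < i + k)%N -> (J n lam ^+ k) i j = 0.
Proof.
elim: k i j => [|k IH] i j h; first by rewrite expr0 mxE; case: eqP h => // ->; lia.
rewrite exprSr mxE big1 // => l _.
case: (ltnP l (i + k)) => hl; first by rewrite IH // mul0r.
by rewrite mxE; case: eqP => [h'|]; rewrite ?mulr0 //; lia.
Qed.

Lemma Jordan0_nilp n lam k : (n <= k)%N -> J n lam ^+ k = 0.
Proof.
move=> h; apply/matrixP => i j; rewrite Jordan0_upper ?mxE //.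
by have := ltn_ord j; lia.
Qed.

Lemma Jordan0_block n k (i j : 'I_n) :
  (J n [:: n] ^+ k) i j = (j == (i + k)%N :> nat)%:R.
Proof.
elim: k i j => [|k IH] i j; first by rewrite expr0 mxE addn0 eq_sym.
have starts (l : 'I_n) : l.+1 \in block_starts [:: n] = (l.+1 == n).
  by rewrite block_starts_cons block_starts_nil !inE /= addn0.
rewrite exprS mxE; case: (ltnP i.+1 n) => hi.
  rewrite (bigD1 (Ordinal hi)) //= IH mxE /= eqxx starts neq_ltn hi /= mul1r.
  rewrite addSn addnS big1 ?addr0 // => l hl.
  by rewrite mxE; case: eqP => [h|]; rewrite ?mul0r //; case/eqP: hl; apply: val_inj.
rewrite big1; last first.
  move=> l _; rewrite mxE; case: eqP => [h|]; rewrite ?mul0r //.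
  by have := ltn_ord l; lia.
by case: eqP => // h; have := ltn_ord j; lia.
Qed.

(** The first [n - k] rows of the power [A] are distinct unit vectors and the others vanish. Thus
    [A *m A^T = pid_mx (n - k)] bounds the rank below and [pid_mx (n - k) *m A = A] bounds it
    above. *)
Lemma rank_Jordan0_block n k : \rank (J n [:: n] ^+ k) = (n - k)%N.
Proof.
case: (leqP n k) => [h|h]; first by rewrite Jordan0_nilp // mxrank0; lia.
set A := _ ^+ k.
have hAA : A *m A^T = pid_mx (n - k).
  apply/matrixP => i j; rewrite !mxE.
  under eq_bigr do rewrite mxE !Jordan0_block.
  case: (ltnP i (n - k)) => hi.
    have hi' : (i + k < n)%N by lia.
    rewrite (bigD1 (Ordinal hi')) //= eqxx mul1r eqn_add2r big1 ?addr0 ?andbT //.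
    by move=> l hl; case: eqP => [h'|]; rewrite ?mul0r //; case/eqP: hl; apply: val_inj.
  rewrite andbF big1 // => l _; case: eqP => [h'|]; rewrite ?mul0r //.
  by have := ltn_ord l; lia.
have hA : pid_mx (n - k) *m A = A.
  apply/matrixP => i j; rewrite mxE (bigD1 i) //= mxE eqxx /= big1 ?addr0.
    case: (ltnP i (n - k)) => hi; rewrite ?mul1r // mul0r Jordan0_upper //.
    by have := ltn_ord j; lia.
  move=> l hl; rewrite mxE; case: eqP => [/val_inj e|_]; last by rewrite mul0r.
  by rewrite e eqxx in hl.
have rp : \rank (pid_mx (n - k) : 'M[C]_n) = (n - k)%N.
  by rewrite rank_pid_mx ?leq_subr.
apply/eqP; rewrite eqn_leq -{2}rp -hAA mxrankM_maxl andbT.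
by rewrite -{1}hA; apply: leq_trans (mxrankM_maxl _ _) _; rewrite rp.
Qed.

Lemma block_diag_expr a m (A : 'M[C]_a) (B : 'M[C]_m) k :
  block_mx A 0 0 B ^+ k = block_mx (A ^+ k) 0 0 (B ^+ k).
Proof.
elim: k => [|k IH]; first by rewrite !expr0 -scalar_mx_block.
rewrite !exprS IH -!mulmxE mulmx_block !mul0mx !mulmx0 !addr0 !add0r.
by [].
Qed.

Lemma rank_Jordan0 lam k :
  \rank (J (sumn lam) lam ^+ k) = sumn [seq (a - k)%N | a <- lam].
Proof.
elim: lam => [|a lam IH] /=; first by rewrite [_ ^+ k]flatmx0 mxrank0.
by rewrite Jordan0_cons block_diag_expr rank_diag_block_mx rank_Jordan0_block IH.
Qed.

Lemma sumn_subS (lam : seq nat) k :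
  (sumn [seq (a - k)%N | a <- lam] =
   sumn [seq (a - k.+1)%N | a <- lam] + count (ltn k) lam)%N.
Proof. by elim: lam => //= a lam ->; lia. Qed.

(** The drop in rank from the power [k] to [k + 1] counts the parts larger than [k]. Differences of
    these counts are the multiplicities of the parts, which determine a sorted list. *)
Lemma partition_rank_inj n lam mu :
  is_partition n lam -> is_partition n mu ->
  (forall k, \rank (J n lam ^+ k) = \rank (J n mu ^+ k)) -> lam = mu.
Proof.
move=> [sl pl hl] [sm pm hm] hr.
have hs k : sumn [seq (a - k)%N | a <- lam] = sumn [seq (a - k)%N | a <- mu].
  by rewrite -!rank_Jordan0 hl hm.
have hc k : count (ltn k) lam = count (ltn k) mu.
  by have := hs k; rewrite (sumn_subS lam) (sumn_subS mu) hs => /addnI.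
apply: (sorted_eq _ _ sl sm) => [x y z h1 h2|x y h|].
- exact: leq_trans h2 h1.
- by apply/eqP; rewrite eqn_leq andbC.
- have split s k : count (ltn k) s = (count_mem k.+1 s + count (ltn k.+1) s)%N.
    by elim: s => //= a s ->; lia.
  apply/allP => [[|x]] _; last first.
    apply/eqP; have := hc x.
    by rewrite (split lam) (split mu) hc => /addIn.
  have h0 s : all (fun k => 0 < k)%N s -> count_mem 0%N s = 0%N.
    by elim: s => //= a s IH /andP[ha /IH ->]; case: a ha.
  by rewrite /= !h0.
Qed.

(* [v A^i] (i < k) spans a cyclic subspace, and the common kernel of the
   functionals [A^j f] is an invariant complement because the Hankel matrix of
   the [v A^(i+j) f] is antitriangular. *)
Lemma nilpotent_cyclic_split n k (A : 'M[C]_n) (v : 'rV[C]_n) (f : 'cV[C]_n) :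
  A ^+ k.+1 = 0 -> v *m A ^+ k *m f != 0 ->
  (k.+1 <= n)%N /\
  forall m (e : n = (k.+1 + m)%N), exists (g : 'M_n) (A' : 'M_m),
    [/\ g \in unitmx, A' ^+ k.+1 = 0 &
       g *m A = castmx (esym e, esym e) (block_mx (J k.+1 [:: k.+1]) 0 0 A') *m g].
Proof.
move=> Ak hv.
pose V : 'M[C]_(k.+1, n) := \matrix_i (v *m A ^+ i).
pose P : 'M[C]_(n, k.+1) := (\matrix_j (A ^+ j *m f)^T)^T.
have VPE i j : (V *m P) i j = (v *m A ^+ (i + j) *m f) 0 0.
  rewrite exprD -mulmxE -!mulmxA mulmxA; rewrite !mxE; apply: eq_bigr => l _.
  by rewrite !mxE; congr (_ * _); rewrite !mxE.
have VPfree : row_free (V *m P).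
  rewrite -kermx_eq0; apply/rowV0P => x /sub_kermxP hx; apply: contrapT => /eqP x0.
  have /rV0Pn[i0 hi0] := x0.
  (* Take the first nonzero coordinate [j] of a left kernel vector and read column [k - j]. Earlier
     terms vanish by minimality, later ones contain a power of [A] above [k], so only [v A^k f]
     survives. *)
  pose p i := [exists j : 'I_k.+1, (j == i :> nat) && (x 0 j != 0)].
  have /ex_minnP[i /existsP[j /andP[/eqP ji xj]] imin] : exists i, p i.
    by exists i0; apply/existsP; exists i0; rewrite eqxx.
  have hxj := congr1 (fun M : 'rV_k.+1 => M 0 (rev_ord j)) hx.
  rewrite !mxE (bigD1 j) //= VPE [X in _ + X]big1 in hxj; last first.
    move=> l hl; case: (ltnP l j) => hlj.
      suff -> : x 0 l = 0 by rewrite mul0r.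
      apply: contrapT => /eqP xl; have : p l by apply/existsP; exists l; rewrite eqxx.
      by move/imin; lia.
    rewrite VPE (_ : (l + _)%N = k.+1 + (l - j.+1))%N; last first.
      have := ltn_ord j; have : val l != val j by []. by rewrite /=; lia.
    by rewrite exprD Ak mul0r mulmx0 mul0mx mxE mulr0.
  have Ek : (j + rev_ord j)%N = k by rewrite /=; have := ltn_ord j; lia.
  rewrite addr0 Ek in hxj; move/eqP: hxj; rewrite mulf_eq0 (negbTE xj) /=.
  move=> h; case/eqP: hv; apply/matrixP => a b; rewrite !ord1 (eqP h).
  by rewrite mxE.
have kn : (k.+1 <= n)%N.
  by move: VPfree => /eqP <-; apply: leq_trans (mxrankM_maxl _ _) (rank_leq_col _).
split=> // m e; subst n.
have rP : \rank P = k.+1.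
  apply/eqP; rewrite eqn_leq rank_leq_col /=.
  by move: VPfree => /eqP {1}<-; apply: mxrankM_maxr.
have rK : \rank (kermx P) = m by rewrite mxrank_ker rP addKn.
pose W := castmx (rK, erefl) (row_base (kermx P)).
have WK : (W :=: kermx P)%MS.
  by apply: eqmx_trans (eqmx_cast _ _) (eq_row_base _).
have WP : W *m P = 0 by apply/sub_kermxP; rewrite WK.
have Wfree : row_free W by rewrite /row_free WK rK.
have VA : V *m A = J k.+1 [:: k.+1] *m V.
  apply/row_matrixP => i; rewrite !row_mul rowK -mulmxA mulmxE -exprSr.
  have Ji l : row i (J k.+1 [:: k.+1]) 0 l = (l == i.+1 :> nat)%:R.
    by rewrite mxE -[J _ _]expr1 Jordan0_block addn1.
  case: (ltnP i.+1 k.+1) => hi.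
    apply/rowP => j; rewrite [RHS]mxE (bigD1 (Ordinal hi)) //=.
    rewrite Ji eqxx mul1r big1 ?addr0.
      by rewrite [RHS]mxE.
    move=> l hl; rewrite Ji; case: eqP => [h|]; rewrite ?mul0r //.
    by case/eqP: hl; apply: val_inj.
  have -> : i.+1 = k.+1 by have := ltn_ord i; lia.
  rewrite Ak mulmx0; apply/rowP => j; rewrite mxE [RHS]mxE big1 // => l _.
  by rewrite Ji; case: eqP => [h|]; rewrite ?mul0r //; have := ltn_ord l; lia.
(* The kernel of [P] is stable because [A] sends each column of [P] to the next one, and the last
   one to 0. *)
have /submxP[A' WA] : (W *m A <= W)%MS.
  rewrite WK; apply/sub_kermxP.
  have colP_ (j : 'I_k.+1) : col j P = A ^+ j *m f by rewrite -tr_row rowK trmxK.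
  have WAf l : W *m (A ^+ l *m f) = 0.
    case: (ltnP l k.+1) => hl.
      rewrite -[l]/(val (Ordinal hl)) -colP_ -col_mul.
      by rewrite WP col0.
    by rewrite -(subnKC hl) exprD Ak mul0r mul0mx mulmx0.
  have e0 j : col j (W *m A *m P) = 0.
    by rewrite col_mul colP_ -mulmxA mulmxA -mulmxA [A *m _]mulmxA mulmxE -exprS WAf.
  apply/matrixP => x j; have := congr1 (fun M : 'cV_m => M x 0) (e0 j).
  by rewrite [LHS]mxE [RHS]mxE => ->; rewrite mxE.
have A'k : A' ^+ k.+1 = 0.
  have Wi i : W *m A ^+ i = A' ^+ i *m W.
    elim: i => [|i IH]; first by rewrite !expr0 mulmx1 mul1mx.
    by rewrite exprSr -mulmxE mulmxA IH -mulmxA WA mulmxA mulmxE -exprSr.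
  by apply: (row_free_inj Wfree); rewrite -Wi Ak mulmx0 mul0mx.
exists (col_mx V W), A'; split=> //.
  rewrite -row_free_unit -kermx_eq0; apply/rowV0P => x /sub_kermxP.
  rewrite -[x]hsubmxK mul_row_col => hx.
  have hl : lsubmx x = 0.
    apply: (row_free_inj VPfree); rewrite mul0mx.
    have := congr1 (mulmx^~ P) hx; rewrite /= mulmxDl mul0mx -!mulmxA WP mulmx0 addr0.
    by [].
  have hr : rsubmx x = 0.
    by apply: (row_free_inj Wfree); rewrite mul0mx -hx hl mul0mx add0r.
  by rewrite hl hr row_mx0.
by rewrite castmx_id mul_block_col mul_col_mx !mul0mx addr0 add0r VA WA.
Qed.

(** The first alternative is the case [n = 0]. Otherwise [k' + 1] is the nilpotency index, and [v],
    [f] select a nonzero entry of [A ^+ k']. *)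
Lemma nilpotent_index n k (A : 'M[C]_n) : A ^+ k = 0 ->
  1%:M = 0 :> 'M[C]_n \/
  exists k' (v : 'rV[C]_n) (f : 'cV[C]_n),
    [/\ (k' < k)%N, A ^+ k'.+1 = 0 & v *m A ^+ k' *m f != 0].
Proof.
elim: k => [|k IH] Ak; first by left.
have [/IH[|[k' [v [f [h1 h2 h3]]]]]|/eqP/matrix0Pn[i [j hij]]] := pselect (A ^+ k = 0).
- by left.
- by right; exists k', v, f; split=> //; lia.
right; exists k, (delta_mx 0 i), (delta_mx j 0); split=> //.
rewrite -rowE -colE; apply: contraNneq hij => /matrixP/(_ 0 0).
by rewrite !mxE => ->.
Qed.

Lemma nilpotent_expn n k (A : 'M[C]_n) : A ^+ k = 0 -> A ^+ n = 0.
Proof.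
move=> /nilpotent_index[h|[k' [v [f [_ Ak hv]]]]].
  by rewrite -[LHS]mulmx1 h mulmx0.
have [kn _] := nilpotent_cyclic_split Ak hv.
have -> : A ^+ n = A ^+ (k'.+1 + (n - k'.+1)) by rewrite subnKC.
by rewrite exprD Ak mul0r.
Qed.

(** Split off a cyclic block of maximal size and recurse on the complement. The complement is killed
    by the same power, so the bound on the parts keeps the list sorted. *)
Lemma nilpotent_Jordan n k (A : 'M[C]_n) : A ^+ k = 0 ->
  exists lam (g : 'M_n), [/\ is_partition n lam, all (geq k) lam,
    g \in unitmx & g *m A = J n lam *m g].
Proof.
elim/ltn_ind: n => n IH in k A *.
case: n => [|n] in A IH *.
  move=> _; exists [::], 1%:M; split=> //; first exact: unitmx1.
  by rewrite [LHS]flatmx0 [RHS]flatmx0.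
move=> /nilpotent_index[/matrixP/(_ 0 0)/eqP|[k' [v [f [hk Ak hv]]]]].
  by rewrite !mxE eqxx oner_eq0.
have [kn] := nilpotent_cyclic_split Ak hv.
move=> /(_ (n.+1 - k'.+1)%N).
have := subnKC kn; have : (n.+1 - k'.+1 < n.+1)%N by lia.
move: (n.+1 - k'.+1)%N => m hm e /(_ (esym e)).
move: n.+1 e A Ak v f hv hm IH {kn} => N e A Ak v f hv hm IH.
subst N => -[g [A' [gu A'k gA]]]; rewrite castmx_id in gA.
have [lam [h [[s1 s2 s3] hlam hu hA]]] := IH m hm _ _ A'k.
exists (k'.+1 :: lam), (block_mx 1%:M 0 0 h *m g); split.
- split=> /=; [|exact: s2|by rewrite s3].
  by rewrite path_min_sorted.
- rewrite /= hk /=; apply: sub_all hlam => x /=; rewrite /geq /=; lia.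
- by rewrite unitmx_mul gu andbT unitmxE det_lblock det1 mul1r -unitmxE.
- rewrite -mulmxA gA Jordan0_cons !mulmxA !mulmx_block.
  by rewrite !mul0mx !mulmx0 !mul1mx !mulmx1 !addr0 !add0r hA.
Qed.

End JordanForm.

(** * The slice transversal to a conjugacy class *)

Lemma lin_mulmx1 (F : comNzRingType) n p : lin_mulmx 1%:M = 1%:M :> 'M[F]_(n * p).
Proof.
apply/row_matrixP => i; rewrite row1 rowE -[delta_mx 0 i]vec_mxK mul_vec_lin.
by rewrite /= mul1mx.
Qed.

Section Slice.
Variables (R : realType) (n : nat).
Local Notation C := (complex R).
Variables (J S : 'M[C]_n).
Hypothesis SS : S *m S = 1%:M.
Hypothesis SJ : S *m J = - (J *m S).

Definition conj_pair (g B0 : 'M[C]_n) : 'M[C]_n * 'M[C]_n :=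
  (g *m J *m invmx g, g *m B0 *m invmx g).

Lemma conj_pairP g B0 x : g \in unitmx -> x.1 *m g = g *m J -> x.2 *m g = g *m B0 ->
  x = conj_pair g B0.
Proof.
case: x => A B /= gu e1 e2; congr (_, _).
  by rewrite -e1 mulmxK.
by rewrite -e2 mulmxK.
Qed.

Lemma conj_pair1 g B0 : g \in unitmx -> (conj_pair g B0).1 *m g = g *m J.
Proof. by move=> gu; rewrite mulmxKV. Qed.

Lemma conj_pair2 g B0 : g \in unitmx -> (conj_pair g B0).2 *m g = g *m B0.
Proof. by move=> gu; rewrite mulmxKV. Qed.

(** The adjugate is the determinant times the inverse, so one factor [\det g] clears the
    denominators of a conjugate. *)
Lemma ratmap_conj_pair D (g B0 : 'rV[C]_D -> 'M[C]_n) :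
  regmx (@rvcrd C D) g -> regmx (@rvcrd C D) B0 ->
  ratmap (fun y => \det (g y)) (fun y => conj_pair (g y) (B0 y)).
Proof.
move=> hg hB; split=> [|[b [i j]]]; first exact: regfun_det.
have hM (N : 'rV_D -> 'M_n) : regmx (@rvcrd C D) N ->
    regfun (@rvcrd C D) (fun y => (g y *m N y *m \adj (g y)) i j).
  by move=> hN; apply: (regmx_mul (regmx_mul hg hN) (regmx_adj hg)).
have det_conj (h N : 'M[C]_n) : \det h != 0 ->
    (h *m N *m \adj h) i j = \det h * (h *m N *m invmx h) i j.
  move=> hd; rewrite /invmx unitmxE unitfE hd -scalemxAr [in RHS]mxE mulrA.
  by rewrite mulfV // mul1r.
case: b.
  exists (fun y => (g y *m J *m \adj (g y)) i j) => [|y dy]; last exact: det_conj.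
  exact/hM/regmx_const.
exists (fun y => (g y *m B0 y *m \adj (g y)) i j) => [|y dy]; first exact/hM.
exact: det_conj.
Qed.

(** On matrices read as row vectors, [E] is [c -> c J - J c]. The rows of [K] form a basis of the
    centralizer of [J], [P] reads coordinates in it, the rows of [Q] span the complement [ker P],
    and [u0] holds the coordinates of the identity. *)
Let E : 'M[C]_(n * n) := lin_mulmxr J - lin_mulmx J.
Let r := \rank (kermx E).
Let K : 'M[C]_(r, n * n) := row_base (kermx E).
Let P := pinvmx K.
Let Q := row_base (kermx P).
Let u0 := mxvec 1%:M *m P.

Let KP : K *m P = 1%:M.
Proof. by rewrite mulmxVp ?row_base_free. Qed.

Let QQ : Q *m pinvmx Q = 1%:M.
Proof. exact: mulmxVp (row_base_free _). Qed.

Let QP : Q *m P = 0.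
Proof. by apply/sub_kermxP; rewrite eq_row_base. Qed.

Let ker_P (v : 'rV_(n * n)) : v *m P = 0 -> exists w, v = w *m Q.
Proof. by move=> vP; apply/submxP; rewrite eq_row_base; apply/sub_kermxP. Qed.

Let mulE (c A : 'M[C]_n) :
  mxvec c *m (lin_mulmxr J - lin_mulmx A) = mxvec (c *m J - A *m c).
Proof. by rewrite mulmxBr !mul_vec_lin linearB. Qed.

Let commE (c : 'M[C]_n) : c *m J = J *m c -> c = vec_mx (mxvec c *m P *m K).
Proof.
move=> cJ; have /submxP[u e] : (mxvec c <= K)%MS.
  by rewrite eq_row_base; apply/sub_kermxP; rewrite mulE cJ subrr linear0.
by rewrite e -[u *m K *m P]mulmxA KP mulmx1 -e mxvecK.
Qed.

Let comm_vec u : vec_mx (u *m K) *m J = J *m vec_mx (u *m K).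
Proof.
apply/eqP; rewrite -subr_eq0 -(inj_eq (can_inj (@mxvecK _ _ _))) -mulE vec_mxK linear0.
have /sub_kermxP KE : (K <= kermx E)%MS by rewrite eq_row_base.
by rewrite -mulmxA KE mulmx0.
Qed.

Let antiE B0 : J *m B0 + B0 *m J = 0 <-> exists u, B0 = S *m vec_mx (u *m K).
Proof.
split=> [h|[u ->]].
  exists (mxvec (S *m B0) *m P); rewrite -commE; first by rewrite mulmxA SS mul1mx.
  have e : B0 *m J = - (J *m B0) by apply/eqP; rewrite -subr_eq0 opprK addrC h.
  by rewrite -mulmxA e mulmxN [S *m (J *m B0)]mulmxA SJ mulNmx opprK -mulmxA.
by rewrite -mulmxA comm_vec !mulmxA SJ mulNmx subrr.
Qed.

(** This parametrization is onto the orbits, which gives irreducibility, but it has [r] parameters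
    too many for the dimension. *)
Let big_g (y : 'rV[C]_(n * n + r)) : 'M[C]_n := vec_mx (lsubmx y).
Let big_B (y : 'rV[C]_(n * n + r)) : 'M[C]_n := S *m vec_mx (rsubmx y *m K).
Let bigd y := \det (big_g y).
Let bigphi y := conj_pair (big_g y) (big_B y).

Let regmx_big_g : regmx (@rvcrd C _) big_g.
Proof. exact/regmx_vec_mx/regmx_lsubmx. Qed.

Let ratmap_big : ratmap bigd bigphi.
Proof.
apply: ratmap_conj_pair => //; apply: regmx_mul; first exact: regmx_const.
by apply/regmx_vec_mx/regmx_mul; [exact: regmx_rsubmx|exact: regmx_const].
Qed.

Definition anticommuting_orbits (x : 'M[C]_n * 'M[C]_n) :=
  exists g B0, [/\ g \in unitmx, J *m B0 + B0 *m J = 0 & x = conj_pair g B0].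

Let orbitsE : anticommuting_orbits = ratimage bigd bigphi.
Proof.
apply: seteq_eq => x; split=> [[g [B0 [gu /antiE[u ->] ->]]]|[y dy ->]].
  exists (row_mx (mxvec g) u).
    by rewrite /bigd /big_g row_mxKl mxvecK -unitfE -unitmxE.
  by rewrite /bigphi /big_g /big_B row_mxKl row_mxKr mxvecK.
exists (big_g y), (big_B y); split=> //.
by apply/antiE; exists (rsubmx y).
Qed.

Lemma irreducible_orbits : irreducible (zclosure anticommuting_orbits).
Proof.
rewrite orbitsE; apply: irreducible_ratimage => //.
by exists (row_mx (mxvec 1%:M) 0); rewrite /bigd /big_g row_mxKl mxvecK det1 oner_eq0.
Qed.

(** Confining [g] to the affine space [1 + ker P] removes the [r] directions of the centralizer and
    leaves [n ^ 2] parameters. *)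
Let a := \rank (kermx P).
Let sl_g (y : 'rV[C]_(a + r)) : 'M[C]_n := 1%:M + vec_mx (lsubmx y *m Q).
Let sl_B (y : 'rV[C]_(a + r)) : 'M[C]_n := S *m vec_mx (rsubmx y *m K).
Let sld y := \det (sl_g y).
Let slphi y := conj_pair (sl_g y) (sl_B y).

Let ratmap_sl : ratmap sld slphi.
Proof.
apply: ratmap_conj_pair.
  apply: regmx_add; first exact: regmx_const.
  by apply/regmx_vec_mx/regmx_mul; [exact: regmx_lsubmx|exact: regmx_const].
apply: regmx_mul; first exact: regmx_const.
by apply/regmx_vec_mx/regmx_mul; [exact: regmx_rsubmx|exact: regmx_const].
Qed.

Let dim_sl : (a + r = n ^ 2)%N.
Proof.
have rP : \rank P = r.
  apply/eqP; rewrite eqn_leq rank_leq_col /=.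
  by rewrite -{1}[r](mxrank1 C) -KP mxrankM_maxr.
by rewrite /a mxrank_ker rP subnK ?rank_leq_row // -[X in (X <= _)%N]rP rank_leq_row.
Qed.

Let sl_sub : subset (ratimage sld slphi) anticommuting_orbits.
Proof.
move=> _ [y dy ->]; exists (sl_g y), (sl_B y); split=> //.
by apply/antiE; exists (rsubmx y).
Qed.

(** For [c] in the centralizer with coordinates [u], the product [g c] lies in [1 + ker P] exactly
    when [u *m T g = u0]. Cramer's rule solves this system, and [c' g] is the solution times
    [\det (T g)]. *)
Let T (g : 'M[C]_n) : 'M[C]_r := K *m lin_mulmx g *m P.
Let c' g : 'M[C]_n := vec_mx (u0 *m \adj (T g) *m K).

Let T1 : T 1%:M = 1%:M.
Proof. rewrite /T lin_mulmx1 mulmx1; exact: KP. Qed.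

Let c'1 : c' 1%:M = 1%:M.
Proof. by rewrite /c' T1 adj1 mulmx1 -commE // mul1mx mulmx1. Qed.

(* Right multiplication of [g] by the element [c' g / det (T g)] of the
   centralizer of [J] brings it into the slice. *)
Let slice_point g B0 : \det g != 0 -> \det (T g) != 0 -> \det (c' g) != 0 ->
  J *m B0 + B0 *m J = 0 -> ratimage sld slphi (conj_pair g B0).
Proof.
rewrite -!unitfE -!unitmxE => gu; rewrite unitmxE unitfE => Tg cu hB.
pose c := (\det (T g))^-1 *: c' g.
have cJ : c *m J = J *m c by rewrite -scalemxAl comm_vec scalemxAr.
have cu' : c \in unitmx by rewrite unitmxZ // unitfE invr_neq0.
pose h := g *m c.
have hu : h \in unitmx by rewrite unitmx_mul gu.
have hP : mxvec h *m P = u0.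
  have e : mxvec (c' g) *m lin_mulmx g *m P = \det (T g) *: u0.
    transitivity (u0 *m \adj (T g) *m T g); first by rewrite /c' /T vec_mxK !mulmxA.
    by rewrite -mulmxA mul_adj_mx mul_mx_scalar.
  by rewrite /h -mul_vec_lin /c linearZ /= -!scalemxAl e scalerA mulVf // scale1r.
have [w hw] : exists w, mxvec (h - 1%:M) = w *m Q.
  by apply: ker_P; rewrite linearB /= mulmxBl hP subrr.
(* Replacing [g] by [g c] replaces [B0] by its conjugate under [c], which still anticommutes with
   [J]. *)
have [u hu'] : exists u, invmx c *m B0 *m c = S *m vec_mx (u *m K).
  apply/antiE; rewrite -[_ *m c *m J]mulmxA cJ !mulmxA.
  have -> : J *m invmx c = invmx c *m J.
    by apply: (can_inj (mulmxK cu')); rewrite mulmxKV // -mulmxA -cJ mulKmx.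
  by rewrite -mulmxDl -!mulmxA -mulmxDr hB mulmx0 mul0mx.
have Eh : sl_g (row_mx w u) = h by rewrite /sl_g row_mxKl -hw mxvecK addrC subrK.
exists (row_mx w u); first by rewrite /sld Eh -unitfE -unitmxE.
rewrite /slphi /sl_B row_mxKr Eh -hu'; apply: conj_pairP; first exact: hu.
  by rewrite /h mulmxA conj_pair1 // -!mulmxA cJ.
by rewrite /h mulmxA conj_pair2 // !mulmxA mulmxK.
Qed.

(** A generic point of the large parametrization falls in the image of the slice: the three
    determinants asked for by [slice_point] are polynomials that do not vanish at [g = 1]. *)
Let sl_dense f : polyfun f -> (forall x, ratimage sld slphi x -> f x = 0) ->
  forall x, anticommuting_orbits x -> f x = 0.
Proof.
move=> hf f0; rewrite orbitsE => _ [y1 dy1 ->].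
have [m [p hp pE]] := ratmap_polyfun ratmap_big hf.
apply: contrapT => /eqP fy1.
pose q y := \det (big_g y) * \det (T (big_g y)) * \det (c' (big_g y)).
have hT : regmx (@rvcrd C _) (fun y => T (big_g y)).
  apply: regmx_mul; last exact: regmx_const.
  by apply: regmx_mul; [exact: regmx_const|exact: regmx_lin_mulmx].
have hq : regfun (@rvcrd C _) q.
  apply: regfun_mul; first by apply: regfun_mul; exact: regfun_det.
  apply/regfun_det/regmx_vec_mx/regmx_mul; last exact: regmx_const.
  by apply: regmx_mul; [exact: regmx_const|exact: regmx_adj].
have [y []] : exists y, p y != 0 /\ q y != 0.
  apply: (regfun_common_nonzero (y := y1) (z := row_mx (mxvec 1%:M) 0)) => //.
    by rewrite pE // mulf_neq0 ?expf_neq0.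
  by rewrite /q /big_g row_mxKl mxvecK T1 c'1 !det1 !mulr1 oner_eq0.
rewrite /q !mulf_eq0 !negb_or => py /andP[/andP[dy Ty] cy].
rewrite pE // f0 ?mulr0 ?eqxx // in py.
by apply: slice_point => //; apply/antiE; exists (rsubmx y).
Qed.

(* On the slice, [h] is recovered from [A = h J h^-1] as the only solution of
   the linear system [h J = A h], [mxvec h *m P = u0]; [Mx A] extracts as many
   equations as unknowns, so that Cramer's rule gives [h = hx A / det (Mx A)]. *)
Let W := pinvmx (row_mx E P).
Let Mx (A : 'M[C]_n) : 'M[C]_(n * n) := row_mx (lin_mulmxr J - lin_mulmx A) P *m W.
Let hx (A : 'M[C]_n) : 'M[C]_n := vec_mx (row_mx 0 u0 *m W *m \adj (Mx A)).

(** A vector killed by [E] is in the span of [K], where [P] is injective. So [row_mx E P] is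
    row-free and [W] is a right inverse of it. *)
Let MJ : Mx J = 1%:M.
Proof.
rewrite /Mx /W mulmxVp // -kermx_eq0; apply/rowV0P => v /sub_kermxP.
rewrite mul_mx_row -[0]row_mx0 => /eq_row_mx[vE vP].
have /submxP[u e] : (v <= K)%MS by rewrite eq_row_base; apply/sub_kermxP.
by rewrite e -mulmxA KP mulmx1 in vP; rewrite e vP mul0mx.
Qed.

Let hxE A h : h *m J = A *m h -> mxvec h *m P = u0 -> hx A = \det (Mx A) *: h.
Proof.
move=> e1 e2.
have -> : hx A = vec_mx (mxvec h *m Mx A *m \adj (Mx A)).
  by rewrite /hx /Mx mulmxA mul_mx_row mulE e1 subrr linear0 e2.
by rewrite -mulmxA mul_mx_adj mul_mx_scalar linearZ /= mxvecK.
Qed.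

(** The inverse takes the coordinates of [h - 1] along [Q] and of [S h^-1 B h] along [K]. Their
    denominators are [\det (Mx A)] and, since conjugation ignores the scaling of [h], [\det (hx A)];
    multiplying by [del] clears both. *)
Let del (x : 'M[C]_n * 'M[C]_n) := \det (Mx x.1) * \det (hx x.1).
Let psi (x : 'M[C]_n * 'M[C]_n) : 'rV[C]_(a + r) :=
  row_mx (\det (hx x.1) *: (mxvec (hx x.1 - \det (Mx x.1) *: 1%:M) *m pinvmx Q))
         (\det (Mx x.1) *: (mxvec (S *m (\adj (hx x.1) *m x.2 *m hx x.1)) *m P)).

Let regmx_Mx : regmx (@Xcrd R n) (fun x => Mx x.1).
Proof.
apply: regmx_mul; last exact: regmx_const.
apply: regmx_row_mx; last exact: regmx_const.
apply: regmx_add; first exact: regmx_const.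
exact/regmx_opp/regmx_lin_mulmx/regmx_fst.
Qed.

Let regmx_hx : regmx (@Xcrd R n) (fun x => hx x.1).
Proof.
apply/regmx_vec_mx/regmx_mul; first exact: regmx_const.
exact: regmx_adj regmx_Mx.
Qed.

Let regmx_psi : regmx (@Xcrd R n) psi.
Proof.
apply: regmx_row_mx; apply: regmx_scale; try exact: regfun_det.
  apply: regmx_mul; last exact: regmx_const.
  apply: regmx_mxvec; apply: regmx_add => //; apply: regmx_opp.
  by apply: regmx_scale; [exact: regfun_det|exact: regmx_const].
apply: regmx_mul; last exact: regmx_const.
apply: regmx_mxvec; apply: regmx_mul; first exact: regmx_const.
by apply: regmx_mul => //; apply: regmx_mul; [exact: regmx_adj|exact: regmx_snd].
Qed.

Let psiE y : sld y != 0 -> psi (slphi y) = del (slphi y) *: y.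
Proof.
move=> dy; have hu : sl_g y \in unitmx by rewrite unitmxE unitfE.
set x := slphi y; have e1 : sl_g y *m J = x.1 *m sl_g y by rewrite conj_pair1.
have e2 : x.2 *m sl_g y = sl_g y *m sl_B y by rewrite conj_pair2.
have hP : mxvec (sl_g y) *m P = u0.
  by rewrite /sl_g linearD /= mulmxDl vec_mxK -mulmxA QP mulmx0 addr0.
have eh := hxE e1 hP.
rewrite -[in RHS](hsubmxK y) scale_row_mx /psi /del; congr row_mx.
  rewrite eh -scalerBr /sl_g addrAC subrr add0r linearZ /= vec_mxK -scalemxAl.
  rewrite -(mulmxA (lsubmx y)) QQ mulmx1 scalerA; congr (_ *: _); exact: mulrC.
have -> : \adj (hx x.1) *m x.2 *m hx x.1 = \det (hx x.1) *: sl_B y.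
  rewrite {2}eh -scalemxAr -mulmxA e2 mulmxA scalemxAl scalemxAr -eh.
  by rewrite mul_adj_mx mul_scalar_mx.
have e3 : S *m sl_B y = vec_mx (rsubmx y *m K) by rewrite /sl_B mulmxA SS mul1mx.
rewrite -scalemxAr e3 linearZ /= vec_mxK -scalemxAl -[_ *m K *m P]mulmxA.
by rewrite KP mulmx1 scalerA.
Qed.

Lemma dim_orbits : dim_eq (zclosure anticommuting_orbits) (n ^ 2).
Proof.
rewrite -dim_sl; split.
  have sl0 : sl_g 0 = 1%:M by rewrite /sl_g linear0 mul0mx linear0 addr0.
  apply: (chain_exists (psi := fun i x => psi x 0 i) (del := del) ratmap_sl).
  - exact: zclosed_zclosure.
  - by move=> x /sl_sub; apply: sub_zclosure.
  - by move=> i; apply/polyfunP.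
  - by apply/polyfunP; apply: regfun_mul; exact: regfun_det.
  - by move=> i y dy; rewrite psiE // mxE mulrC.
  - by rewrite /sld sl0 det1 oner_eq0.
  (* The origin lies over [A = J], where [h = 1] solves the system and both determinants are 1. *)
  - have E1 : (slphi 0).1 = J by rewrite /slphi sl0 /conj_pair /= mul1mx invmx1 mulmx1.
    rewrite /del E1 (@hxE J 1%:M) ?mulmx1 ?mul1mx // MJ det1 scale1r det1 mulr1.
    by rewrite oner_eq0.
apply: (chain_upper_bound ratmap_sl) => f hf f0 x /zclosureP; apply=> //.
exact: sl_dense.
Qed.

End Slice.

(** * The components *)

Section Components.
Variables (R : realType) (n : nat).
Local Notation C := (complex R).
Local Notation X := ('M[C]_n * 'M[C]_n)%type.
Local Notation J := (@Jordan0 R n).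

Definition signs : 'M[C]_n := diag_mx (\row_i (-1) ^+ i).

Lemma signs_sqr : signs *m signs = 1%:M.
Proof.
apply/matrixP => i j; rewrite mul_diag_mx !mxE mulrnAr.
by rewrite -expr2 sqrr_sign.
Qed.

Lemma signs_Jordan0 lam : signs *m J lam = - (J lam *m signs).
Proof.
apply/matrixP => i j; rewrite mul_diag_mx mul_mx_diag !mxE.
case: eqP => [->|_] /=; last by rewrite mulr0 mul0r oppr0.
by case: ifP => _; rewrite ?mulr0 ?mul0r ?oppr0 // exprS mulr1 mul1r mulN1r opprK.
Qed.

(** The uniform exponent turns nilpotency into a closed condition. *)
Lemma nilpotentP (A : 'M[C]_n) : nilpotent A <-> A ^+ n = 0.
Proof.
have iterE k : iter k (mulmx A) 1%:M = A ^+ k.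
  by elim: k => //= k ->; rewrite exprS.
split=> [[k]|h]; first by rewrite iterE; apply: nilpotent_expn.
by exists n; rewrite iterE.
Qed.

Lemma conj_expr (g A : 'M[C]_n) k : g \in unitmx ->
  (g *m A *m invmx g) ^+ k = g *m A ^+ k *m invmx g.
Proof.
move=> gu; elim: k => [|k IH]; first by rewrite !expr0 mulmx1 mulmxV.
by rewrite !exprS IH -!mulmxE !mulmxA mulmxKV.
Qed.

Lemma orbits_lamE lam : @orbits_lam R n lam = anticommuting_orbits (J lam).
Proof.
apply: seteq_eq => x; split=> [[g [B [gu [h _] ->]]]|[g [B [gu h ->]]]].
  by exists g, B.
by exists g, B; split=> //; split=> //; apply/nilpotentP/Jordan0_nilp.
Qed.

Lemma irreducible_Nlam lam : irreducible (@Nlam R n lam).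
Proof.
by rewrite /Nlam orbits_lamE; apply: irreducible_orbits signs_sqr (signs_Jordan0 lam).
Qed.

Lemma dim_Nlam lam : dim_eq (@Nlam R n lam) (n ^ 2).
Proof.
by rewrite /Nlam orbits_lamE; apply: dim_orbits signs_sqr (signs_Jordan0 lam).
Qed.

Lemma regmx_expr (I Y : Type) (crd : I -> Y -> C) (M : Y -> 'M[C]_n) k :
  regmx crd M -> regmx crd (fun y => M y ^+ k).
Proof.
move=> hM; elim: k => [|k IH]; first exact: regmx_const.
have -> : (fun y => M y ^+ k.+1) = (fun y => M y *m M y ^+ k).
  by apply: funext => y; rewrite exprS.
exact: regmx_mul.
Qed.

Lemma zclosed_Nvar : zclosed (@Nvar R n).
Proof.
have -> : @Nvar R n = fun x => x.1 *m x.2 + x.2 *m x.1 = 0 /\ x.1 ^+ n = 0.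
  by apply: seteq_eq => x; split=> -[h /nilpotentP].
apply: zclosedI; apply: zclosed_regmx; last exact/regmx_expr/regmx_fst.
by apply: regmx_add; apply: regmx_mul; by [exact: regmx_fst|exact: regmx_snd].
Qed.

Lemma Nlam_sub_Nvar lam : subset (@Nlam R n lam) (@Nvar R n).
Proof.
apply: zclosure_min; first exact: zclosed_Nvar.
move=> _ [g [B [gu [/= h /nilpotentP nJ] ->]]]; split=> /=.
  rewrite !mulmxA !mulmxKV // -!mulmxA -mulmxDr !mulmxA -mulmxDl h.
  by rewrite mul0mx mulmx0.
by apply/nilpotentP; rewrite conj_expr // nJ mulmx0 mul0mx.
Qed.

Lemma Nvar_cover x : Nvar x -> exists2 lam, is_partition n lam & @Nlam R n lam x.
Proof.
case: x => A B [/= hAB /nilpotentP An].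
have [lam [g [hlam _ gu gA]]] := nilpotent_Jordan An.
exists lam => //; apply: sub_zclosure; rewrite orbits_lamE.
exists (invmx g), (g *m B *m invmx g); split; first by rewrite unitmx_inv.
  have -> : J lam = g *m A *m invmx g by rewrite gA mulmxK.
  rewrite !mulmxA !mulmxKV // -!mulmxA -mulmxDr !mulmxA -mulmxDl hAB.
  by rewrite mul0mx mulmx0.
apply: conj_pairP => /=; first by rewrite unitmx_inv.
  by apply: (can_inj (mulKmx gu)); rewrite mulKVmx // mulmxA gA mulmxK.
by rewrite !mulmxA mulVmx // mul1mx.
Qed.

(** Length and parts of a partition of [n] are at most [n], so it suffices to filter the finitely
    many lists within these bounds. *)
Lemma finite_partitions :
  exists L : seq (seq nat), forall lam, lam \in L <-> is_partition n lam.
Proof.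
have [L hL] : exists L : seq (seq nat), forall lam, is_partition n lam -> lam \in L.
  have bounded k : exists L : seq (seq nat), forall s : seq nat,
      (size s <= k)%N -> all (geq n) s -> s \in L.
    elim: k => [|k [L hL]]; first by exists [:: [::]] => -[].
    exists ([::] :: [seq a :: s | a <- iota 0 n.+1, s <- L]).
    move=> [|a s] hs; first by rewrite inE eqxx.
    move=> /andP[ha hs']; rewrite inE; apply/orP; right.
    by apply/allpairsP; exists (a, s); split=> //; [rewrite mem_iota ltnS|apply: hL].
  have [L hL] := bounded n; exists L => lam [_ pos e]; apply: hL.
    by rewrite -{}e; elim: lam pos => //= a lam IH /andP[a0 /IH]; lia.
  apply/allP => a /= ain; rewrite -e.
  by rewrite (perm_sumn (perm_to_rem ain)) /= leq_addr.
pose p lam := [&& sorted geq lam, all (fun k => 0 < k)%N lam & sumn lam == n].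
have pP lam : p lam <-> is_partition n lam.
  by split=> [/and3P[h1 h2 /eqP h3]|[h1 h2 /eqP h3]]; [split|apply/and3P; split].
exists (filter p L) => lam; rewrite mem_filter; split=> [/andP[/pP]//|h].
by rewrite hL // andbT; apply/pP.
Qed.

Lemma irreducible_sub_Nlam W : irreducible W -> subset W (@Nvar R n) ->
  exists2 lam, is_partition n lam & subset W (@Nlam R n lam).
Proof.
move=> irr WN; have [L hL] := finite_partitions.
have [lam|x /WN/Nvar_cover[lam hlam hx]|lam /hL hlam hs] :=
    irreducible_cover (s := L) (Y := @Nlam R n) irr.
- exact: zclosed_zclosure.
- by exists lam => //; apply/hL.
- by exists lam.
Qed.

(** Were the inclusion strict, a chain of length [n ^ 2] in the smaller variety, topped by the
    larger one, would be too long for the latter's dimension. *)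
Lemma Nlam_maximal lam mu :
  subset (@Nlam R n lam) (@Nlam R n mu) -> @Nlam R n mu = @Nlam R n lam.
Proof.
move=> sub; have [nsub|nsub] := pselect (subset (@Nlam R n mu) (@Nlam R n lam)).
  by apply: seteq_eq => x; split=> [/nsub|/sub].
have [[Fc [h1 h2]] _] := dim_Nlam lam; have [_ []] := dim_Nlam mu.
exists (fun i => if (i <= n ^ 2)%N then Fc i else @Nlam R n mu); split=> i hi.
  case: ifP => hi'; last first.
    by split; [exact: zclosed_zclosure|exact: irreducible_Nlam|].
  by have [c irr s] := h1 i hi'; split; [exact: c|exact: irr|move=> x /s; exact: sub].
have -> : (i <= n ^ 2)%N by [].
case: (ltnP i (n ^ 2)) => hi'; first exact: h2.
have {hi hi'}-> : i = (n ^ 2)%N by apply/eqP; rewrite eqn_leq -ltnS hi.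
have [_ _ s] := h1 _ (leqnn (n ^ 2)).
split=> [x /s|h]; first exact: sub.
by apply: nsub => x /h; exact: s.
Qed.

(** With [L] and [U] chosen so that [L *m J lam ^+ k *m U] is the identity of size [s], the function
    [\det (L *m A ^+ k *m U)] would vanish on all of [Nlam mu] if the rank for [mu] were below [s],
    yet it is 1 at [(J lam, 0)]. *)
Lemma rank_Nlam lam mu k : subset (@Nlam R n lam) (@Nlam R n mu) ->
  (\rank (J lam ^+ k) <= \rank (J mu ^+ k))%N.
Proof.
move=> sub; rewrite leqNgt; apply/negP => hlt.
set s := \rank (J lam ^+ k) in hlt.
have /row_fullP[L hL] := col_base_full (J lam ^+ k).
have /row_freeP[U hU] := row_base_free (J lam ^+ k).
have LU : L *m J lam ^+ k *m U = 1%:M.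
  have e : L *m J lam ^+ k = row_base (J lam ^+ k).
    by rewrite -[RHS]mul1mx -hL -mulmxA mulmx_base.
  by rewrite e hU.
pose f (x : X) := \det (L *m x.1 ^+ k *m U).
have hf : polyfun f.
  apply/polyfunP/regfun_det/regmx_mul; last exact: regmx_const.
  by apply: regmx_mul; [exact: regmx_const|exact/regmx_expr/regmx_fst].
have : f (J lam, 0) = 0.
  have /sub/zclosureP : Nlam lam (J lam, 0 : 'M[C]_n).
    apply: sub_zclosure; rewrite orbits_lamE; exists 1%:M, 0.
    by rewrite unitmx1 mulmx0 mul0mx addr0 /conj_pair invmx1 !mulmx1 !mul1mx.
  apply=> // _ [g [B [gu _ ->]]]; apply/eqP.
  rewrite /f /= conj_expr // -[_ == 0]negbK -unitfE -unitmxE -row_free_unit /row_free.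
  rewrite neq_ltn; apply/orP; left; apply: leq_ltn_trans hlt.
  apply: leq_trans (mxrankM_maxl _ _) _; apply: leq_trans (mxrankM_maxr _ _) _.
  by apply: leq_trans (mxrankM_maxl _ _) _; exact: mxrankM_maxr.
by rewrite /f /= LU det1 => /eqP; rewrite oner_eq0.
Qed.

Lemma Nlam_inj lam mu : is_partition n lam -> is_partition n mu ->
  seteq (@Nlam R n lam) (@Nlam R n mu) -> lam = mu.
Proof.
move=> hl hm /seteq_eq e; apply: (@partition_rank_inj R n) => // k.
have sub_refl nu : subset (@Nlam R n nu) (@Nlam R n nu) by move=> x hx; exact: hx.
apply/eqP; rewrite eqn_leq; apply/andP.
by split; apply: rank_Nlam; rewrite e; apply: sub_refl.
Qed.

(** Every irreducible subset lies in some member of the finite cover. A component therefore equals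
    that member by maximality, and conversely [Nlam_maximal] squeezes any irreducible set lying
    between [Nlam lam] and [Nvar]. *)
Lemma components_Nvar Z : irreducible_component (@Nvar R n) Z <->
  exists lam, is_partition n lam /\ seteq Z (@Nlam R n lam).
Proof.
split=> [[ZN [irr hmax]]|[lam [hlam /seteq_eq ->]]].
  have [lam hlam Zlam] := irreducible_sub_Nlam irr ZN.
  exists lam; split=> //.
  have h := hmax _ (irreducible_Nlam lam) Zlam (@Nlam_sub_Nvar lam).
  by move=> x; split=> /h.
split; first exact: Nlam_sub_Nvar.
split; first exact: irreducible_Nlam.
move=> W irr lamW WN; have [mu _ Wmu] := irreducible_sub_Nlam irr WN.
move=> x; split=> [/Wmu|/lamW] //.
by rewrite (@Nlam_maximal lam mu) // => y /lamW/Wmu.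
Qed.

End Components.

Theorem theorem6p3 (R : realType) (n : nat) (hn : (1 <= n)%N) :
  (forall Z : 'M[complex R]_n * 'M[complex R]_n -> Prop,
     irreducible_component (@Nvar R n) Z <->
     exists lam, is_partition n lam /\ seteq Z (@Nlam R n lam)) /\
  (forall lam mu, is_partition n lam -> is_partition n mu ->
     seteq (@Nlam R n lam) (@Nlam R n mu) -> lam = mu) /\
  (forall lam, is_partition n lam -> dim_eq (@Nlam R n lam) (n ^ 2)).
Proof.
split; first by move=> Z; exact: components_Nvar.
by split=> [lam mu|lam _]; [exact: Nlam_inj|exact: dim_Nlam].
Qed.
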